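(* Let $R>0$, $0<d\le R/2$, $\nu>0$, and let $k\ne0$ be a tangential Fourier frequency. Let $$Z_4=\int_I\int_{C_{R,d}}rF^4\,dr\,dz\,dt .$$ Then the native trace energy $\mathcal E_k$ satisfies $$\mathcal E_k\le\frac{2R^2|k|d}{\nu}Z_4 .$$ If $d\le c/|k|$ for some $c>0$, then $$\mathcal E_k\le\frac{2cR^2}{\nu}Z_4 .$$
   Context: Cylindrical coordinates $(r,z)$, time $t$ in an interval $I$; $F=u^\theta/r$ is a real function on the collar $C_{R,d}=\{R-d\le r\le R+d\}$ (with $z$ ranging over the tangential domain). Define $$\mu(z,t)=\int_{R-d}^{R+d}F(r,z,t)^2\,dr\ge0,$$ and let $\mu_k(t)$ be its tangential ($z$) Fourier coefficient at frequency $k$, with the $L^2$-normalized convention in which $|\mu_k(t)|\le\|\mu(\cdot,t)\|_{L^2_z}$. The native sheet is $\sigma_k=ik\mu_k$, and the decaying two-sided transmission law at zero temporal frequency is $\sigma_k=2\nu|k|f_k$, so $f_k=\frac{i\,\mathrm{sgn}\,k}{2\nu}\mu_k$. The weighted native trace energy is $$\mathcal E_k=2\nu R^3|k|\int_I|f_k|^2\,dt=\frac{R^3|k|}{2\nu}\int_I|\mu_k|^2\,dt .$$ *)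

(* Defs.v *)
From HB Require Import structures.
From mathcomp Require Import all_boot all_order all_algebra.
From mathcomp Require Import all_classical all_reals all_analysis.
From mathcomp Require Import complex ring.

Set Implicit Arguments.
Unset Strict Implicit.
Unset Printing Implicit Defensive.

Import Order.TTheory GRing.Theory Num.Theory.
Import numFieldNormedType.Exports.

Local Open Scope classical_set_scope.
Local Open Scope ring_scope.

(* The tangential variable z lives on the circle of length L, represented by
   its fundamental domain [0, L[; a field is a function F r z t. *)

Definition tangential_domain (R : realType) (L : R) : set R := `[0, L[.

Definition tangential_frequency (R : realType) (L k : R) : Prop :=
  exists n : int, k = 2 * pi * n%:~R / L.

Definition collar (R : realType) (R0 d L : R) : set (R * R) :=
  `[R0 - d, R0 + d] `*` tangential_domain L.

(* The embedding of R in R[i] and the modulus, valued in R, are the ones of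
   mathcomp's complex.v; the integral of a complex function is taken
   componentwise. *)

Definition cintegral (R : realType) (D : set R) (g : R -> R[i]) : R[i] :=
  Complex (Rintegral lebesgue_measure D (fun x => complex.Re (g x)))
          (Rintegral lebesgue_measure D (fun x => complex.Im (g x))).

Definition expi (R : realType) (x : R) : R[i] := Complex (cos x) (sin x).

(* Rintegral is real-valued: it is 0 where the integral of F^2 is infinite. *)
Definition mu_density (R : realType) (R0 d : R) (F : R -> R -> R -> R)
    (z t : R) : R :=
  Rintegral lebesgue_measure `[R0 - d, R0 + d] (fun r => F r z t ^+ 2).

(* Coefficient against the orthonormal system L^(-1/2) exp(ikz) of
   L^2(0, L), so that |mu_k(t)| <= ||mu(., t)||_(L^2). *)
Definition fourier_coef (R : realType) (L k : R) (g : R -> R) : R[i] :=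
  real_complex R (Num.sqrt L)^-1 *
  cintegral (tangential_domain L)
    (fun z => real_complex R (g z) * expi (- (k * z))).

Definition mu_coef (R : realType) (R0 d L k : R) (F : R -> R -> R -> R)
    (t : R) : R[i] :=
  fourier_coef L k (fun z => mu_density R0 d F z t).

Definition native_sheet (R : realType) (R0 d L k : R) (F : R -> R -> R -> R)
    (t : R) : R[i] :=
  'i%C * real_complex R k * mu_coef R0 d L k F t.

(* The solution f_k of the transmission law sigma_k = 2 nu |k| f_k. *)
Definition native_trace (R : realType) (R0 d L nu k : R)
    (F : R -> R -> R -> R) (t : R) : R[i] :=
  native_sheet R0 d L k F t / real_complex R (2 * nu * `|k|).

Definition native_trace_energy (R : realType) (R0 d L nu k : R)
    (F : R -> R -> R -> R) (I : set R) : \bar R :=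
  ((2 * nu * R0 ^+ 3 * `|k|)%:E *
   \int[lebesgue_measure]_(t in I)
     (Normc.normc (native_trace R0 d L nu k F t) ^+ 2)%:E)%E.

Definition Z4 (R : realType) (R0 d L : R) (F : R -> R -> R -> R)
    (I : set R) : \bar R :=
  (\int[lebesgue_measure]_(t in I)
     \int[lebesgue_measure \x lebesgue_measure]_(p in collar R0 d L)
       (p.1 * F p.1 p.2 t ^+ 4)%:E)%E.

Lemma transmission_law (R : realType) (R0 d L nu k : R)
    (F : R -> R -> R -> R) (t : R) : 0 < nu -> k != 0 ->
  native_sheet R0 d L k F t =
  real_complex R (2 * nu * `|k|) * native_trace R0 d L nu k F t.
Proof.
move=> nu0 k0; rewrite /native_trace mulrC divfK //.
rewrite fmorph_eq0 !mulf_neq0 ?normr_eq0 ?pnatr_eq0 //.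
by rewrite gt_eqF.
Qed.

Lemma native_traceE (R : realType) (R0 d L nu k : R)
    (F : R -> R -> R -> R) (t : R) : 0 < nu -> k != 0 ->
  native_trace R0 d L nu k F t =
  'i%C * real_complex R (Num.sg k / (2 * nu)) * mu_coef R0 d L k F t.
Proof.
move=> nu0 k0; rewrite /native_trace /native_sheet.
have -> : real_complex R (Num.sg k / (2 * nu)) =
    real_complex R k / real_complex R (2 * nu * `|k|).
  rewrite -fmorphV -[RHS]rmorphM; congr (real_complex R _).
  have nk0 : `|k| != 0 by rewrite normr_eq0.
  move: (numEsg k) nk0; move: (Num.sg k) `|k| => s a -> a0; field.
  by rewrite a0 gt_eqF.
by rewrite mulrAC !mulrA.
Qed.

(* Main.v *)
(** If c^2 + s^2 = 1 pointwise on a set of measure m, put a = \int h c and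
    b = \int h s. Integrating (m h - (a c + b s))^2 >= 0, where
    (a c + b s)^2 <= a^2 + b^2, gives a^2 + b^2 <= m \int h^2. With
    (c, s) = (1, 0) this is the Cauchy-Schwarz bound mu^2 <= 2d \int F^4 dr; with
    (cos, sin) it is the bound of a Fourier coefficient by the L^2 norm. Both
    combine by Tonelli, and r >= R0 / 2 on the collar turns F^4 into
    (2 / R0) r F^4. *)

Require Import Defs.
From HB Require Import structures.
From mathcomp Require Import all_boot all_order all_algebra.
From mathcomp Require Import all_classical all_reals all_analysis.
From mathcomp Require Import complex ring lra measurable_realfun.

Import Order.TTheory GRing.Theory Num.Theory.
Import numFieldNormedType.Exports.

Local Open Scope classical_set_scope.
Local Open Scope ring_scope.

(* Unlike [ge0_le_integral], this applies to t |-> |f_k t|^2 without first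
   establishing its measurability: the integral is a supremum over simple
   functions. *)
Lemma ge0_le_integralZl {d} {T : measurableType d} {R : realType}
    (mu : {measure set T -> \bar R}) {D : set T} {f g : T -> \bar R} (c : R) :
  0 < c -> (forall x, D x -> (0 <= f x)%E) ->
  (forall x, D x -> (f x <= c%:E * g x)%E) ->
  (\int[mu]_(x in D) f x <= c%:E * \int[mu]_(x in D) g x)%E.
Proof.
move=> c0 f0 fg; have cV0 : 0 <= c^-1 by rewrite invr_ge0 ltW.
have fVg x : D x -> (c^-1%:E * f x <= g x)%E.
  by move=> Dx; rewrite lee_pdivrMl// fg.
have g0 x : D x -> (0 <= g x)%E.
  by move=> Dx; apply: le_trans (fVg x Dx); rewrite mule_ge0// f0.
rewrite !ge0_integralE//; apply: ge_ereal_sup => _ [h hf <-].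
rewrite -lee_pdivrMl// -sintegralrM.
(* A simple function [h] below [f] becomes, after scaling by [c^-1], a simple function below [g], so
   it competes in the supremum for [g]. *)
apply: ereal_sup_ubound; exists (scale_nnsfun h cV0) => // x /=.
rewrite EFinM; move: (hf x); rewrite !patchE; case: ifPn => [/set_mem Dx|_] hx.
  by apply: le_trans (fVg x Dx); rewrite lee_wpmul2l.
by rewrite -[leRHS](mule0 c^-1%:E) lee_wpmul2l.
Qed.

Lemma Rintegral_quadrature {d} {T : measurableType d} {R : realType}
    (mu : {measure set T -> \bar R}) {D : set T} {m : R} {h c s : T -> R} :
  measurable D -> 0 < m -> mu D = m%:E ->
  measurable_fun D h -> measurable_fun D c -> measurable_fun D s ->
  (forall x, D x -> c x ^+ 2 + s x ^+ 2 = 1) ->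
  (((\int[mu]_(x in D) (h x * c x))%R ^+ 2 +
    (\int[mu]_(x in D) (h x * s x))%R ^+ 2)%:E
   <= m%:E * \int[mu]_(x in D) (h x ^+ 2)%:E)%E.
Proof.
move=> mD m0 muD mh mc ms cs.
have mh2 : measurable_fun D (fun x => h x ^+ 2) by exact: measurable_funX.
(* If [h] is not square integrable, the right-hand side is infinite because [m > 0], whatever
   default values the real integrals on the left take. *)
have [hoo|hfin] := eqVneq (\int[mu]_(x in D) (h x ^+ 2)%:E)%E +oo%E.
  by rewrite hoo gt0_muley ?lte_fin// leey.
have i2 : mu.-integrable D (EFin \o (fun x => h x ^+ 2)).
  apply/integrableP; split; first exact/measurable_EFinP.
  rewrite (eq_integral (fun x => (h x ^+ 2)%:E)) ?ltey// => x _ /=.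
  by rewrite ger0_norm// sqr_ge0.
have icst (r : R) : mu.-integrable D (EFin \o cst r).
  apply/integrableP; split; first exact/measurable_EFinP/measurable_cst.
  by rewrite /= integral_cst// muD ltry.
(* Since [e ^+ 2 <= 1], the product [h * e] is dominated by [1 + h ^+ 2], integrable on a set of
   finite measure. *)
have iprod (e : T -> R) : measurable_fun D e ->
    (forall x, D x -> e x ^+ 2 <= 1) -> mu.-integrable D (EFin \o (h \* e)).
  move=> me e1; apply: (le_integrable mD (g := EFin \o (fun x => 1 + h x ^+ 2))).
  - by apply/measurable_EFinP; exact: measurable_funM.
  - move=> x Dx; rewrite /= lee_fin.
    have h2 : 0 <= 1 + h x ^+ 2 by rewrite addr_ge0// sqr_ge0.
    rewrite (ger0_norm h2) -(@ler_pXn2r _ 2) ?nnegrE// -normrX ger0_norm ?sqr_ge0//.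
    rewrite exprMn (le_trans (ler_wpM2l (sqr_ge0 _) (e1 x Dx)))//.
    by have := sqr_ge0 (h x); move: (h x ^+ 2) => y; nra.
  - by apply: (integrableD mD (icst 1) i2).
have ihc : mu.-integrable D (EFin \o (h \* c)).
  by apply: iprod => // x Dx; rewrite -(cs x Dx) lerDl sqr_ge0.
have ihs : mu.-integrable D (EFin \o (h \* s)).
  by apply: iprod => // x Dx; rewrite -(cs x Dx) lerDr sqr_ge0.
set a := Rintegral _ _ _; set b := Rintegral _ _ _; set t := a ^+ 2 + b ^+ 2.
have -> : (\int[mu]_(x in D) (h x ^+ 2)%:E)%E =
    (\int[mu]_(x in D) (h x ^+ 2))%:E.
  by rewrite fineK//; exact: integrable_fin_num i2.
rewrite -EFinM lee_fin.
set u := (X in _ <= m * X).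
(* The expanded square is integrated with its cross term on the left: that term contributes
   [2 * m * (a ^+ 2 + b ^+ 2)], and the constant [t] contributes [m * t]. Cancelling [m > 0] leaves
   [t <= m * u]. *)
suff : m * (2 * t) <= m ^+ 2 * u + m * t by nra.
have ia := integrableZl mD (2 * m * a) ihc.
have ib := integrableZl mD (2 * m * b) ihs.
have im := integrableZl mD (m ^+ 2) i2.
have -> : m * (2 * t) = (\int[mu]_(x in D)
    (2 * m * a * (h x * c x) + 2 * m * b * (h x * s x)))%R.
  by rewrite RintegralD// !RintegralZl// /t -/a -/b; ring.
have -> : m ^+ 2 * u + m * t = (\int[mu]_(x in D) (m ^+ 2 * h x ^+ 2 + t))%R.
  rewrite (RintegralD mD im (icst t)) RintegralZl// (Rintegral_cst mu mD).
  by rewrite muD -/u (mulrC t).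
apply: le_Rintegral => //.
- exact: (integrableD mD ia ib).
- exact: (integrableD mD im (icst t)).
- move=> x Dx; rewrite -subr_ge0.
  (* By Lagrange's identity, [(a * s x - b * c x) ^+ 2] is the gap between [t] and
     [(a * c x + b * s x) ^+ 2] when [c x ^+ 2 + s x ^+ 2 = 1]; the last summand then vanishes. *)
  have -> : m ^+ 2 * h x ^+ 2 + t -
      (2 * m * a * (h x * c x) + 2 * m * b * (h x * s x)) =
      (m * h x - (a * c x + b * s x)) ^+ 2 + (a * s x - b * c x) ^+ 2 +
      t * (1 - (c x ^+ 2 + s x ^+ 2)) by rewrite /t; ring.
  by rewrite cs// subrr mulr0 addr0 addr_ge0// sqr_ge0.
Qed.

Lemma measurable_fun_slice {d1 d2 d3} {T1 : measurableType d1}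
    {T2 : measurableType d2} {T3 : measurableType d3} {A : set T1} {B : set T2}
    {f : T1 * T2 -> T3} {y : T2} :
  measurable A -> measurable B -> measurable_fun (A `*` B) f -> B y ->
  measurable_fun A (fun x => f (x, y)).
Proof.
move=> mA mB mf By.
apply: (measurable_comp (F := A `*` B) (g := fun x => (x, y)) _ _ mf).
- exact: measurableX.
- by move=> _ [x Ax <-].
- exact: measurable_funTS (pair2_measurable y).
Qed.

Section rectangle.
Context {d1 d2} {T1 : measurableType d1} {T2 : measurableType d2} {R : realType}
  (m1 : {sigma_finite_measure set T1 -> \bar R})
  (m2 : {sigma_finite_measure set T2 -> \bar R})
  {A : set T1} {B : set T2} {f : T1 * T2 -> \bar R}.
Hypotheses (mA : measurable A) (mB : measurable B)
  (mf : measurable_fun (A `*` B) f) (f0 : forall p, (A `*` B) p -> (0 <= f p)%E).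

Let mfAB : measurable_fun setT (f \_ (A `*` B)).
Proof. by apply/(measurable_restrictT f (measurableX mA mB)). Qed.

Let fAB0 p : (0 <= (f \_ (A `*` B)) p)%E.
Proof. by rewrite patchE; case: ifPn => // /set_mem/f0. Qed.

(** Extending [f] by zero reduces the rectangle to the full product space: the section at [y]
    outside [B] is zero, and at [y] in [B] it is supported in [A]. *)
Let fubini_GE : fubini_G m1 (f \_ (A `*` B)) =
  (fun y => \int[m1]_(x in A) f (x, y))%E \_ B.
Proof.
apply/funext => y; rewrite /fubini_G patchE; case: ifPn => yB.
  rewrite [RHS]integral_mkcond; apply: eq_integral => x _.
  by rewrite !patchE in_setX /= yB andbT.
by rewrite integral0_eq// => x _; rewrite patchE in_setX (negbTE yB) andbF.
Qed.

Lemma measurable_integral_rectangle :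
  measurable_fun B (fun y => \int[m1]_(x in A) f (x, y))%E.
Proof.
apply/measurable_restrictT => //; rewrite -fubini_GE.
exact: measurable_fun_fubini_tonelli_G.
Qed.

Lemma integral_rectangle :
  (\int[m1 \x m2]_(p in A `*` B) f p =
   \int[m2]_(y in B) \int[m1]_(x in A) f (x, y))%E.
Proof.
by rewrite integral_mkcond fubini_tonelli2// fubini_GE [RHS]integral_mkcond.
Qed.

End rectangle.

Lemma sqr_normc_ReIm {R : rcfType} (z : R[i]) :
  Normc.normc z ^+ 2 = complex.Re z ^+ 2 + complex.Im z ^+ 2.
Proof. by case: z => a b; rewrite /= sqr_sqrtr// addr_ge0// sqr_ge0. Qed.

Lemma fourier_coef_bound {R : realType} {L : R} (k : R) {g : R -> R} : 0 < L ->
  measurable_fun (tangential_domain L) g ->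
  ((Normc.normc (fourier_coef L k g) ^+ 2)%:E <=
   \int[lebesgue_measure]_(z in tangential_domain L) (g z ^+ 2)%:E)%E.
Proof.
move=> L0 mg.
have mk : measurable_fun setT (fun z : R => - (k * z)).
  by apply: measurable_funN; exact: measurable_funM.
have mcos : measurable_fun (tangential_domain L) (fun z => cos (- (k * z))).
  apply: measurable_funTS; apply: (measurableT_comp _ mk).
  by apply: continuous_measurable_fun; exact: continuous_cos.
have msin : measurable_fun (tangential_domain L) (fun z => sin (- (k * z))).
  apply: measurable_funTS; apply: (measurableT_comp _ mk).
  by apply: continuous_measurable_fun; exact: continuous_sin.
have muD : lebesgue_measure (tangential_domain L) = L%:E.
  by rewrite lebesgue_measure_itv /= lte_fin L0 oppr0 adde0.
(* The factor [L] is the measure [m] of the quadrature bound; it cancels the square of the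
   normalization [L^(-1/2)]. *)
rewrite -(@lee_pmul2l _ L%:E)// ?lte_fin//.
have := Rintegral_quadrature lebesgue_measure (measurable_itv _) L0 muD mg mcos msin
  (fun x _ => cos2Dsin2 _).
apply: le_trans.
rewrite -EFinM lee_fin Normc.normcM exprMn !sqr_normc_ReIm /=.
(* As [g] is real, the real and imaginary parts of the integrand are [g] times the cosine and [g]
   times the sine. *)
under eq_Rintegral do rewrite mul0r subr0.
under [X in _ * (_ * (_ + X ^+ 2)) <= _]eq_Rintegral do rewrite mul0r addr0.
by rewrite expr0n addr0 exprVn (sqr_sqrtr (ltW L0)) mulVKf ?gt_eqF.
Qed.

Lemma mu_density_bound {R : realType} {R0 d : R} {F : R -> R -> R -> R}
    {z t : R} : 0 < d ->
  measurable_fun `[R0 - d, R0 + d] (fun r => F r z t) ->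
  ((mu_density R0 d F z t ^+ 2)%:E <= (2 * d)%:E *
   \int[lebesgue_measure]_(r in `[(R0 - d)%R, (R0 + d)%R]) (F r z t ^+ 4)%:E)%E.
Proof.
move=> d0 mF.
have d20 : 0 < 2 * d by rewrite mulr_gt0.
have muD : lebesgue_measure (`[R0 - d, R0 + d] : set R) = (2 * d)%:E.
  rewrite lebesgue_measure_itv /= lte_fin ifT; last by lra.
  by rewrite -EFinD; congr EFin; ring.
have one (x : R) : `[R0 - d, R0 + d]%classic x -> (1 : R) ^+ 2 + 0 ^+ 2 = 1.
  by rewrite expr0n expr1n addr0.
have := Rintegral_quadrature lebesgue_measure (measurable_itv _) d20 muD
  (measurable_funX 2 mF) (measurable_cst (1 : R)) (measurable_cst (0 : R)) one.
under eq_integral do rewrite -exprM.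
apply: le_trans; rewrite lee_fin.
under [X in _ <= X ^+ 2 + _]eq_Rintegral do rewrite mulr1.
by rewrite lerDl sqr_ge0.
Qed.

Lemma collar_ge0 {R : realType} {R0 d L : R} {p : R * R} :
  0 < d -> d <= R0 / 2 -> collar R0 d L p -> 0 <= p.1.
Proof.
case: p => r z d0 dR [/=]; rewrite in_itv/= => /andP[Rr _] _.
by move: d0 dR Rr; lra.
Qed.

Lemma mu_coef_bound {R : realType} {R0 d L : R} (k : R) {t : R}
    {F : R -> R -> R -> R} :
  0 < R0 -> 0 < d -> d <= R0 / 2 -> 0 < L ->
  measurable_fun (collar R0 d L) (fun p => F p.1 p.2 t) ->
  ((Normc.normc (mu_coef R0 d L k F t) ^+ 2)%:E <=
   (4 * d / R0)%:E * \int[lebesgue_measure \x lebesgue_measure]_(p in collar R0 d L)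
     (p.1 * F p.1 p.2 t ^+ 4)%:E)%E.
Proof.
move=> R00 d0 dR L0 mF.
have mA : measurable (`[R0 - d, R0 + d] : set R) by [].
have mB : measurable (tangential_domain L) by exact: measurable_itv.
have mF2 : measurable_fun (`[R0 - d, R0 + d] `*` tangential_domain L)
    (fun p => (F p.1 p.2 t ^+ 2)%:E).
  by apply/measurable_EFinP; exact: measurable_funX.
have F20 p : (`[R0 - d, R0 + d] `*` tangential_domain L) p ->
    (0 <= (F p.1 p.2 t ^+ 2)%:E)%E by rewrite lee_fin sqr_ge0.
have mmu : measurable_fun (tangential_domain L) (fun z => mu_density R0 d F z t).
  (* [mu_density] is [fine] of the inner Tonelli integral of [F ^+ 2], hence measurable in [z]. *)
  apply: (measurableT_comp (fine_measurable measurableT)).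
  exact: (measurable_integral_rectangle lebesgue_measure mA mB mF2 F20).
apply: le_trans (fourier_coef_bound _ L0 mmu) _.
have mw : measurable_fun (collar R0 d L) (fun p => (p.1 * F p.1 p.2 t ^+ 4)%:E).
  apply/measurable_EFinP; apply: measurable_funM; last exact: measurable_funX.
  exact: measurable_funTS measurable_fst.
have w0 p : collar R0 d L p -> (0 <= (p.1 * F p.1 p.2 t ^+ 4)%:E)%E.
  by move=> /(collar_ge0 d0 dR) p0; rewrite lee_fin mulr_ge0// exprn_even_ge0.
rewrite (integral_rectangle lebesgue_measure lebesgue_measure mA mB mw w0).
apply: ge0_le_integralZl => [|z _|z Bz]; first by rewrite divr_gt0 ?mulr_gt0.
  by rewrite lee_fin sqr_ge0.
have mFz := measurable_fun_slice mA mB mF Bz.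
apply: le_trans (mu_density_bound d0 mFz) _.
(* Removing the Cauchy-Schwarz factor [2 * d] from [4 * d / R0] leaves [2 / R0], so pointwise it
   remains to see [1 <= r * 2 / R0]. *)
rewrite -lee_pdivlMl ?mulr_gt0// muleA -EFinM.
apply: ge0_le_integralZl => [|r _|r].
- by rewrite !mulr_gt0 ?invr_gt0 ?mulr_gt0.
- by rewrite lee_fin exprn_even_ge0.
rewrite /= in_itv/= => /andP[rR _].
rewrite -EFinM lee_fin mulrA ler_peMl ?exprn_even_ge0//.
have -> : (2 * d)^-1 * (4 * d / R0) * r = r * 2 / R0.
  by field; rewrite !gt_eqF.
by rewrite ler_pdivlMr//; move: dR rR; lra.
Qed.

Lemma sqr_normc_native_trace {R : realType} {R0 d L nu k t : R}
    {F : R -> R -> R -> R} : 0 < nu -> k != 0 ->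
  Normc.normc (native_trace R0 d L nu k F t) ^+ 2 =
  (2 * nu)^-1 ^+ 2 * Normc.normc (mu_coef R0 d L k F t) ^+ 2.
Proof.
move=> nu0 k0; rewrite native_traceE// 2!Normc.normcM !exprMn; congr (_ * _).
rewrite !sqr_normc_ReIm /= !expr0n !addr0 add0r expr1n mul1r exprMn.
by rewrite sqr_sg k0 mul1r.
Qed.

Theorem lemma4p1 (R : realType) (R0 d nu L k : R) (I : interval R)
    (F : R -> R -> R -> R)
    (hR0 : 0 < R0) (hd : 0 < d) (hdR : d <= R0 / 2) (hnu : 0 < nu)
    (hL : 0 < L) (hk : k != 0) (hkL : tangential_frequency L k)
    (mF : measurable_fun (collar R0 d L `*` [set` I])
            (fun p : (R * R) * R => F p.1.1 p.1.2 p.2)) :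
  (native_trace_energy R0 d L nu k F [set` I]
     <= (2 * R0 ^+ 2 * `|k| * d / nu)%:E * Z4 R0 d L F [set` I])%E /\
  (forall c : R, 0 < c -> d <= c / `|k| ->
   (native_trace_energy R0 d L nu k F [set` I]
     <= (2 * c * R0 ^+ 2 / nu)%:E * Z4 R0 d L F [set` I])%E).
Proof.
have k0 : 0 < `|k| by rewrite normr_gt0.
have mI : measurable ([set` I] : set R) by exact: measurable_itv.
have mC : measurable (collar R0 d L) by apply: measurableX; exact: measurable_itv.
have nuk0 : 0 < (2 * nu)^-1 ^+ 2 * (4 * d / R0).
  by rewrite mulr_gt0 ?exprn_gt0 ?invr_gt0 ?divr_gt0 ?mulr_gt0.
have main : (native_trace_energy R0 d L nu k F [set` I]
     <= (2 * R0 ^+ 2 * `|k| * d / nu)%:E * Z4 R0 d L F [set` I])%E.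
  (* The constant is the product of the energy prefactor, the factor [(2 * nu)^-1 ^+ 2] from the
     transmission law, and the [4 * d / R0] of [mu_coef_bound]. *)
  have -> : 2 * R0 ^+ 2 * `|k| * d / nu =
      2 * nu * R0 ^+ 3 * `|k| * ((2 * nu)^-1 ^+ 2 * (4 * d / R0)).
    by field; rewrite !gt_eqF.
  rewrite EFinM -muleA lee_pmul2l//; last first.
    by rewrite lte_fin !mulr_gt0// exprn_gt0.
  apply: ge0_le_integralZl => // t It; first by rewrite lee_fin sqr_ge0.
  have mFt : measurable_fun (collar R0 d L) (fun p => F p.1 p.2 t).
    exact: (measurable_fun_slice mC mI mF It).
  rewrite sqr_normc_native_trace// EFinM [X in (_ <= X * _)%E]EFinM -muleA.
  rewrite lee_pmul2l//; first exact: mu_coef_bound.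
  by rewrite lte_fin exprn_gt0// invr_gt0 mulr_gt0.
(* The second bound follows from the first by [d * |k| <= c]; enlarging the constant is legitimate
   because [Z4] is nonnegative, [r] being nonnegative on the collar. *)
split=> // c c0 dc; apply: le_trans main _.
apply: lee_wpmul2r; first apply: integral_ge0 => t _.
  apply: integral_ge0 => p /(collar_ge0 hd hdR) p0.
  by rewrite lee_fin mulr_ge0// exprn_even_ge0.
rewrite lee_fin ler_pdivrMr// divfK ?gt_eqF//.
move: dc; rewrite ler_pdivlMr// => dc.
have R2 : 0 <= 2 * R0 ^+ 2 by rewrite mulr_ge0// sqr_ge0.
by have := ler_wpM2l R2 dc; rewrite mulrA => h; lra.
Qed.
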